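(* Let $B\times_fF$ be a degenerate warped product, let $X,Y,Z\in\Gamma(TB)$ and $U,V,W\in\Gamma(TF)$ (lifted to $B\times F$), and let $P\in\Gamma(TB)$ (lifted). Let $\overline{\mathcal K}$ be the semi-symmetric metric Koszul form on $B\times_fF$ associated with $P$, let $\overline{\mathcal K}_B$ be the lift of the semi-symmetric metric Koszul form of $(B,g_B)$ associated with $P$, and let $\mathcal K_F$ be the lift of the Koszul form of $(F,g_F)$. Then: (1) $\overline{\mathcal K}(X,Y,Z)=\overline{\mathcal K}_B(X,Y,Z)$; (2) $\overline{\mathcal K}(X,Y,W)=\overline{\mathcal K}(X,W,Y)=\overline{\mathcal K}(W,X,Y)=0$; (3) $\overline{\mathcal K}(X,V,W)=f\,g_F(V,W)\,X(f)$; (4) $\overline{\mathcal K}(V,X,W)=-\overline{\mathcal K}(V,W,X)=f\,g_F(V,W)\,X(f)+f^2g_B(X,P)g_F(V,W)$; (5) $\overline{\mathcal K}(U,V,W)=f^2\,\mathcal K_F(U,V,W)$.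
   Context: A singular semi-Riemannian manifold is a smooth manifold with a smooth symmetric $(0,2)$-tensor field $g=\langle\cdot,\cdot\rangle$, possibly degenerate and of varying signature. Its Koszul form is $\mathcal K(X,Y,Z)=\tfrac12\{X\langle Y,Z\rangle+Y\langle Z,X\rangle-Z\langle X,Y\rangle-\langle X,[Y,Z]\rangle+\langle Y,[Z,X]\rangle+\langle Z,[X,Y]\rangle\}$, and the semi-symmetric metric Koszul form associated with a vector field $P$ is $\overline{\mathcal K}(X,Y,Z)=\mathcal K(X,Y,Z)+g(Y,P)g(X,Z)-g(X,Y)g(P,Z)$. Let $(B,g_B)$, $(F,g_F)$ be singular semi-Riemannian manifolds and $f\in C^\infty(B)$ (which may vanish at some points). The (degenerate) warped product $B\times_fF$ is $B\times F$ with the metric $\pi_B^*(g_B)+(f\circ\pi_B)^2\pi_F^*(g_F)$, where $\pi_B,\pi_F$ are the projections. Functions, vector fields and forms on $B$ and $F$ are identified with their lifts to $B\times F$. *)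

(* Defs.v *)
From HB Require Import structures.
From mathcomp Require Import all_boot all_order all_algebra.
From mathcomp Require Import all_classical all_reals all_analysis.

Set Implicit Arguments.
Unset Strict Implicit.
Unset Printing Implicit Defensive.

Import Order.TTheory GRing.Theory Num.Theory.
Import numFieldNormedType.Exports.

Local Open Scope classical_set_scope.
Local Open Scope ring_scope.

Section SmoothOn.
Context {R : realType} {V W : normedModType R}.

(* Class C^k on an open set A: f and all its iterated directional derivatives
   of order at most k exist and are continuous at every point of A.  For
   finite-dimensional V this is the usual definition by partial derivatives. *)
Fixpoint Ck_on (k : nat) (A : set V) (f : V -> W) : Prop :=
  (forall x, A x -> {for x, continuous f}) /\
  if k is k'.+1 then
    forall v, (forall x, A x -> derivable f x v) /\ Ck_on k' A ('D_v f)
  else True.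

Definition smooth_on (A : set V) (f : V -> W) : Prop :=
  forall k, Ck_on k A f.

End SmoothOn.

Section CkTheory.
Context {R : realType}.
Implicit Types U V W : normedModType R.

Lemma sub_Ck_on V W k (A B : set V) (f : V -> W) :
  A `<=` B -> Ck_on k B f -> Ck_on k A f.
Proof.
move=> AB; elim: k f => [|k IH] f [cf Df]; split=> //.
- by move=> x /AB /cf.
- by move=> x /AB /cf.
- by move=> v; have [df Dv] := Df v; split=> [x /AB /df//|]; exact: IH.
Qed.

Lemma eq_Ck_on V W k (A : set V) (f g : V -> W) : open A ->
  (forall x, A x -> f x = g x) -> Ck_on k A f -> Ck_on k A g.
Proof.
move=> Ao; elim: k f g => [|k IH] f g fg [cf Df].
all: have nfg x : A x -> {near x, f =1 g}
  by move=> Ax; apply: filterS (open_nbhs_nbhs (conj Ao Ax)) => y /fg.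
all: split=> //.
1,2: move=> x Ax; rewrite /prop_for /continuous_at -(fg _ Ax);
  by apply: cvg_trans (cf x Ax); apply: near_eq_cvg; exact: nfg.
move=> v; have [df Dv] := Df v; split=> [x Ax|].
  by apply: near_eq_derivable (df x Ax); exact: nfg.
by apply: IH Dv => x Ax; apply: near_eq_derive; exact: nfg.
Qed.

Lemma Ck_on_cst V W k (A : set V) (w : W) : Ck_on k A (cst w).
Proof.
elim: k w => [|k IH] w; split=> //.
1,2: by move=> x _; exact: cvg_cst.
move=> v; split=> [x _|]; first exact: derivable_cst.
have -> : 'D_v (cst w) = cst 0 by apply/funext => x; exact: derive_cst.
exact: IH.
Qed.

Lemma Ck_on_add V W k (A : set V) (f g : V -> W) : open A ->
  Ck_on k A f -> Ck_on k A g -> Ck_on k A (f + g).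
Proof.
move=> Ao; elim: k f g => [|k IH] f g [cf Df] [cg Dg]; split=> //.
1,2: by move=> x Ax; apply: cvgD; [exact: cf | exact: cg].
move=> v; have [df Dvf] := Df v; have [dg Dvg] := Dg v; split=> [x Ax|].
  by apply: derivableD; [exact: df | exact: dg].
apply: eq_Ck_on (IH _ _ Dvf Dvg) => // x Ax.
by rewrite deriveD; [|exact: df|exact: dg].
Qed.

Lemma Ck_on_linear_comp V W U k (A : set V) (f : V -> W)
    (L : {linear W -> U}) : open A -> continuous L ->
  Ck_on k A f -> Ck_on k A (L \o f).
Proof.
move=> Ao Lc; elim: k f => [|k IH] f [cf Df]; split=> //.
1,2: by move=> x Ax; apply: continuous_comp; [exact: cf | exact: Lc].
move=> v; have [df Dvf] := Df v.
have key x : A x ->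
    (fun h => h^-1 *: (((L \o f) \o shift x) (h *: v) - (L \o f) x)) @ 0^'
      --> L ('D_v f x).
  move=> Ax; have -> : (fun h : R =>
      h^-1 *: (((L \o f) \o shift x) (h *: v) - (L \o f) x)) =
      L \o (fun h : R => h^-1 *: ((f \o shift x) (h *: v) - f x)).
    by apply/funext => h; rewrite /= -(linearB L) -linearZ_LR.
  by apply: continuous_cvg; [exact: Lc | exact: df].
split=> [x Ax|]; first by apply/cvg_ex; exists (L ('D_v f x)); exact: key.
apply: eq_Ck_on (IH _ Dvf) => // x Ax.
by apply/esym/(cvg_lim (@norm_hausdorff _ U)); exact: key.
Qed.

Lemma Ck_on_comp_affine V W U k (A : set W) (f : W -> U)
    (T L : V -> W) : continuous T ->
  (forall h x v, T (h *: v + x) = h *: L v + T x) ->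
  Ck_on k A f -> Ck_on k (T @^-1` A) (f \o T).
Proof.
move=> Tc TL; elim: k f => [|k IH] f [cf Df]; split=> //.
1,2: by move=> x Ax; apply: continuous_comp; [exact: Tc | exact: cf].
move=> v; have [df Dvf] := Df (L v).
have E x : (fun h : R => h^-1 *: (((f \o T) \o shift x) (h *: v) - (f \o T) x))
    = (fun h : R => h^-1 *: ((f \o shift (T x)) (h *: L v) - f (T x))).
  by apply/funext => h /=; rewrite TL.
split=> [x Ax|]; first by rewrite /derivable E; exact: df.
have -> : 'D_v (f \o T) = 'D_(L v) f \o T.
  by apply/funext => x; rewrite /= /derive E.
exact: IH.
Qed.

End CkTheory.

(* A chart with values in R^n; [chart_coord] and [chart_param] are total
   functions, but only the values of the former on [chart_dom] and those of its
   inverse [chart_param] on the image of [chart_dom] are meaningful. *)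
Record chart (R : realType) (T : topologicalType) (n : nat) := Chart {
  chart_dom : set T;
  chart_coord : T -> 'rV[R]_n;
  chart_param : 'rV[R]_n -> T;
  chart_dom_open : open chart_dom;
  chart_image_open : open (chart_coord @` chart_dom);
  chart_coordK : forall p, chart_dom p -> chart_param (chart_coord p) = p;
  chart_coord_continuous :
    forall p, chart_dom p -> {for p, continuous chart_coord};
  chart_param_continuous :
    forall x, (chart_coord @` chart_dom) x -> {for x, continuous chart_param} }.

Record manifold (R : realType) := Manifold {
  carrier :> topologicalType;
  carrier_hausdorff : hausdorff_space carrier;
  carrier_second_countable : @second_countable carrier;
  mdim : nat;
  atlas : set (chart R carrier mdim);
  atlas_cover : forall p, exists2 c, atlas c & chart_dom c p;
  atlas_compat : forall c d, atlas c -> atlas d ->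
    smooth_on (chart_coord c @` (chart_dom c `&` chart_dom d))
      (chart_coord d \o chart_param c) }.
Arguments atlas {R} M : rename.

Section ProductManifold.
Context {R : realType}.

Lemma open_setX (S T : topologicalType) (A : set S) (B : set T) :
  open A -> open B -> open (A `*` B).
Proof.
rewrite !openE => oA oB [p q] [/= Ap Bq].
by exists (A, B) => //; split; [exact: oA | exact: oB].
Qed.

Lemma hausdorff_prod (S T : topologicalType) :
  hausdorff_space S -> hausdorff_space T -> hausdorff_space (S * T)%type.
Proof.
move=> hS hT [p q] [p' q'] cl; congr pair.
- apply: hS => A B pA p'B.
  have [] := cl (A `*` setT) (B `*` setT).
  + by exists (A, setT) => //; split=> //; exact: filterT.
  + by exists (B, setT) => //; split=> //; exact: filterT.
  by move=> [a b] [[/= Aa _] [/= Ba _]]; exists a.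
- apply: hT => A B pA p'B.
  have [] := cl (setT `*` A) (setT `*` B).
  + by exists (setT, A) => //; split=> //; exact: filterT.
  + by exists (setT, B) => //; split=> //; exact: filterT.
  by move=> [a b] [[/= _ Aa] [/= _ Ba]]; exists b.
Qed.

Lemma second_countable_prod (S T : topologicalType) :
  @second_countable S -> @second_countable T ->
  @second_countable (S * T)%type.
Proof.
move=> [A cA [oA bA]] [B cB [oB bB]].
exists [set C.1 `*` C.2 | C in A `*` B].
  by apply: sub_countable (card_image_le _ _) _; exact: countableX.
split=> [_ [[U V] [/= AU BV] <-]|[p q] N [[M M'] [/= pM qM'] MN]].
  by apply: open_setX; [exact: oA | exact: oB].
have [U [AU Up] UM] := bA p M pM; have [V [BV Vq] VM'] := bB q M' qM'.
exists (U `*` V); first by split=> //; exists (U, V).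
by move=> [a b] [/= /UM Ma /VM' Mb]; exact: MN.
Qed.

Lemma chart_image_openI (T : topologicalType) n (c : chart R T n) (V : set T) :
  open V -> open (chart_coord c @` (chart_dom c `&` V)).
Proof.
move=> oV.
have -> : chart_coord c @` (chart_dom c `&` V) = chart_coord c @` chart_dom c `&` chart_param c @^-1` V.
  apply/seteqP; split=> [_ [p [cp Vp] <-]|_ [[p cp <-] /=]].
    by split; [exists p | rewrite /= chart_coordK].
  by rewrite chart_coordK // => Vp; exists p.
rewrite openE => x [cx Vx]; apply: filterI.
  by apply: open_nbhs_nbhs; split=> //; exact: chart_image_open.
apply: (chart_param_continuous cx); exact: open_nbhs_nbhs.
Qed.

Lemma continuous_row_mx (T : topologicalType) m n (f : T -> 'rV[R]_m)
    (g : T -> 'rV[R]_n) (p : T) :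
  {for p, continuous f} -> {for p, continuous g} ->
  {for p, continuous (fun q => row_mx (f q) (g q))}.
Proof.
move=> cf cg A /nbhs_ballP[e /= e0 eA].
have nf : \forall q \near p, ball (f p) e (f q).
  exact: cf (nbhsx_ballx (f p) e e0).
have ng : \forall q \near p, ball (g p) e (g q).
  exact: cg (nbhsx_ballx (g p) e e0).
change (\forall q \near p, A (row_mx (f q) (g q))).
apply: filterS2 nf ng => q; rewrite /ball /= => -[_ fq] [_ gq].
apply: eA; split=> // i j.
by rewrite !mxE; case: (fintype.split j) => k; [exact: fq | exact: gq].
Qed.

Section ProductChart.
Context {S T : topologicalType} {m n : nat}.
Implicit Types (c : chart R S m) (d : chart R T n).

Let pcoord c d (z : S * T) : 'rV[R]_(m + n) :=
  row_mx (chart_coord c z.1) (chart_coord d z.2).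
Let pparam c d (x : 'rV[R]_(m + n)) : S * T :=
  (chart_param c (lsubmx x), chart_param d (rsubmx x)).

Lemma pcoord_image c d A B : pcoord c d @` (A `*` B) =
  lsubmx @^-1` (chart_coord c @` A) `&` rsubmx @^-1` (chart_coord d @` B).
Proof.
apply/seteqP; split=> [_ [[p q] [/= Ap Bq] <-]|x [[p Ap px] [q Bq qx]]].
  by split; rewrite /= /pcoord ?row_mxKl ?row_mxKr; [exists p | exists q].
by exists (p, q) => //; rewrite /pcoord /= px qx hsubmxK.
Qed.

Lemma open_preimage_rV A B : open A -> open B ->
  open ((lsubmx : 'rV[R]_(m + n) -> 'rV[R]_m) @^-1` A `&`
        (rsubmx : 'rV[R]_(m + n) -> 'rV[R]_n) @^-1` B).
Proof.
move=> oA oB; apply: openI; apply: open_comp => // x _.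
- exact: continuous_lsubmx.
- exact: continuous_rsubmx.
Qed.

Program Definition prod_chart c d : chart R (S * T)%type (m + n) :=
  @Chart R (S * T)%type (m + n) (chart_dom c `*` chart_dom d) (pcoord c d) (pparam c d)
    _ _ _ _ _.
Next Obligation. by move=> c d; apply: open_setX; exact: chart_dom_open. Qed.
Next Obligation.
by move=> c d; rewrite pcoord_image; apply: open_preimage_rV; exact: chart_image_open.
Qed.
Next Obligation.
move=> c d [p q] [/= cp dq].
by rewrite /pparam /pcoord /= row_mxKl row_mxKr !chart_coordK.
Qed.
Next Obligation.
move=> c d [p q] [/= cp dq]; apply: continuous_row_mx.
- apply: (@continuous_comp _ _ _ fst (chart_coord c)) => /=; first exact: cvg_fst.
  exact: chart_coord_continuous.
- apply: (@continuous_comp _ _ _ snd (chart_coord d)) => /=; first exact: cvg_snd.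
  exact: chart_coord_continuous.
Qed.
Next Obligation.
move=> c d x; rewrite pcoord_image => -[/= cx dx].
have h1 : {for x, continuous (chart_param c \o lsubmx)}.
  apply: continuous_comp; first exact: continuous_lsubmx.
  exact: chart_param_continuous.
have h2 : {for x, continuous (chart_param d \o rsubmx)}.
  apply: continuous_comp; first exact: continuous_rsubmx.
  exact: chart_param_continuous.
exact: cvg_pair h1 h2.
Qed.

Lemma prod_chart_compat c c' d d' :
  smooth_on (chart_coord c @` (chart_dom c `&` chart_dom c')) (chart_coord c' \o chart_param c) ->
  smooth_on (chart_coord d @` (chart_dom d `&` chart_dom d')) (chart_coord d' \o chart_param d) ->
  smooth_on (chart_coord (prod_chart c d) @`
      (chart_dom (prod_chart c d) `&` chart_dom (prod_chart c' d')))
    (chart_coord (prod_chart c' d') \o chart_param (prod_chart c d)).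
Proof.
move=> sc sd k /=.
have -> : (chart_dom c `*` chart_dom d) `&` (chart_dom c' `*` chart_dom d') =
    (chart_dom c `&` chart_dom c') `*` (chart_dom d `&` chart_dom d').
  by apply/seteqP; split=> [[p q] [[? ?] [? ?]]|[p q] [[? ?] [? ?]]].
rewrite pcoord_image.
set A := lsubmx @^-1` _; set B := rsubmx @^-1` _.
have oA : open (chart_coord c @` (chart_dom c `&` chart_dom c')).
  exact/chart_image_openI/chart_dom_open.
have oB : open (chart_coord d @` (chart_dom d `&` chart_dom d')).
  exact/chart_image_openI/chart_dom_open.
have oAB : open (A `&` B) by exact: open_preimage_rV.
pose il : {linear 'rV[R]_m -> 'rV[R]_(m + n)} := mulmxr (row_mx 1%:M 0).
pose ir : {linear 'rV[R]_n -> 'rV[R]_(m + n)} := mulmxr (row_mx 0 1%:M).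
have ilE : il = row_mx^~ 0 :> (_ -> _).
  by apply/funext => x /=; rewrite mul_mx_row mulmx1 mulmx0.
have irE : ir = row_mx 0 :> (_ -> _).
  by apply/funext => x /=; rewrite mul_mx_row mulmx1 mulmx0.
have ilc : continuous il.
  rewrite ilE => x; apply: (continuous_row_mx (f := id) (g := cst 0)).
  - by move=> U.
  - exact: cst_continuous.
have irc : continuous ir.
  rewrite irE => x; apply: (continuous_row_mx (f := cst 0) (g := id)).
  - exact: cst_continuous.
  - by move=> U.
apply: (@eq_Ck_on _ _ _ _ _ ((il \o ((chart_coord c' \o chart_param c) \o lsubmx)) +
    (ir \o ((chart_coord d' \o chart_param d) \o rsubmx)))) => //.
  move=> x _; rewrite -[LHS]/(il _ + ir _) ilE irE /= add_row_mx addr0 add0r //.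
apply: Ck_on_add => //; apply: Ck_on_linear_comp => //.
- apply: (@sub_Ck_on _ _ _ _ _ A); first by move=> x [].
  apply: (@Ck_on_comp_affine _ _ _ _ _ _ _ lsubmx lsubmx) => //.
  + exact: continuous_lsubmx.
  + by move=> h x v; rewrite linearP.
- apply: (@sub_Ck_on _ _ _ _ _ B); first by move=> x [].
  apply: (@Ck_on_comp_affine _ _ _ _ _ _ _ rsubmx rsubmx) => //.
  + exact: continuous_rsubmx.
  + by move=> h x v; rewrite linearP.
Qed.

End ProductChart.

Program Definition prod_manifold (B F : manifold R) : manifold R :=
  @Manifold R (B * F)%type
    (hausdorff_prod (@carrier_hausdorff R B) (@carrier_hausdorff R F))
    (second_countable_prod (@carrier_second_countable R B)
                           (@carrier_second_countable R F))
    (mdim B + mdim F)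
    [set prod_chart cd.1 cd.2 | cd in atlas B `*` atlas F] _ _.
Next Obligation.
move=> B F [p q]; have [c Bc cp] := atlas_cover p.
have [d Fd dq] := atlas_cover q.
by exists (prod_chart c d) => //; exists (c, d).
Qed.
Next Obligation.
move=> B F _ _ [[c d] [/= Bc Fd] <-] [[c' d'] [/= Bc' Fd'] <-].
by apply: prod_chart_compat; exact: atlas_compat.
Qed.

End ProductManifold.

Section Geometry.
Context {R : realType}.
Implicit Types M N B F : manifold R.

Definition smooth_fun M (h : M -> R) : Prop :=
  forall c, atlas M c -> smooth_on (chart_coord c @` chart_dom c) (h \o chart_param c).

(* Operators on the algebra of smooth functions of M are encoded by total
   functionals on M -> R which vanish on every non-smooth function: in this
   way two operators agreeing on smooth functions are equal. *)
Definition functional M := (M -> R) -> R.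

Definition on_smooth M (v : functional M) : functional M :=
  fun h => if `[< smooth_fun h >] then v h else 0.

(* Tangent vectors at p are the derivations at p of the algebra of smooth
   functions. *)
Record is_tangent M (p : M) (v : functional M) : Prop := IsTangent {
  tangent_linear : forall (a : R) (h k : M -> R),
    smooth_fun h -> smooth_fun k ->
    v (fun q => a * h q + k q) = a * v h + v k;
  tangent_leibniz : forall h k : M -> R,
    smooth_fun h -> smooth_fun k ->
    v (fun q => h q * k q) = v h * k p + h p * v k;
  tangent_on_smooth : forall h : M -> R, ~ smooth_fun h -> v h = 0 }.

Definition field M := M -> functional M.

Record is_vector_field M (X : field M) : Prop := IsVectorField {
  vector_field_tangent : forall p, is_tangent p (X p);
  vector_field_smooth : forall h, smooth_fun h -> smooth_fun (X^~ h) }.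

Definition bracket M (X Y : field M) : field M := fun p =>
  on_smooth (fun h => X p (Y^~ h) - Y p (X^~ h)).

Definition tensor2 M := M -> functional M -> functional M -> R.

(* A smooth symmetric (0,2)-tensor field, with no condition of nondegeneracy
   or constancy of the signature; the values of g p on functionals which are
   not tangent vectors at p are irrelevant. *)
Record is_singular_metric M (g : tensor2 M) : Prop := IsSingularMetric {
  singular_metric_linear : forall p (a : R) (u v w : functional M),
    is_tangent p u -> is_tangent p v -> is_tangent p w ->
    g p (fun h => a * u h + v h) w = a * g p u w + g p v w;
  singular_metric_sym : forall p (v w : functional M),
    is_tangent p v -> is_tangent p w -> g p v w = g p w v;
  singular_metric_smooth : forall X Y : field M,
    is_vector_field X -> is_vector_field Y ->
    smooth_fun (fun p => g p (X p) (Y p)) }.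

Definition koszul M (g : tensor2 M) (X Y Z : field M) (p : M) : R :=
  2^-1 *
  (X p (fun q => g q (Y q) (Z q))
   + Y p (fun q => g q (Z q) (X q))
   - Z p (fun q => g q (X q) (Y q))
   - g p (X p) (bracket Y Z p)
   + g p (Y p) (bracket Z X p)
   + g p (Z p) (bracket X Y p)).

Definition ss_koszul M (g : tensor2 M) (P X Y Z : field M) (p : M) : R :=
  koszul g X Y Z p
  + g p (Y p) (P p) * g p (X p) (Z p) - g p (X p) (Y p) * g p (P p) (Z p).

Definition tangent_map M N (phi : M -> N) (v : functional M) : functional N :=
  on_smooth (fun h => v (h \o phi)).

Definition pullback_tensor M N (phi : M -> N) (g : tensor2 N) : tensor2 M :=
  fun p v w => g (phi p) (tangent_map phi v) (tangent_map phi w).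

Definition warped_metric B F (f : B -> R) (gB : tensor2 B) (gF : tensor2 F) :
    tensor2 (prod_manifold B F) := fun z v w =>
  pullback_tensor (fst : prod_manifold B F -> B) gB z v w
  + f z.1 ^+ 2 * pullback_tensor (snd : prod_manifold B F -> F) gF z v w.

(* The lift to B x F of a vector field X of B is, at (p, q), the image of X p
   by the differential of the inclusion of B as the slice B x {q}. *)
Definition lift_base B F (X : field B) : field (prod_manifold B F) :=
  fun z => tangent_map (fun p => (p, z.2) : prod_manifold B F) (X z.1).

Definition lift_fiber B F (V : field F) : field (prod_manifold B F) :=
  fun z => tangent_map (fun q => (z.1, q) : prod_manifold B F) (V z.2).

End Geometry.
Arguments lift_base {R B} F X.
Arguments lift_fiber {R} B {F} V.

(* Main.v *)
(** Both the metric and the bracket of lifted fields are seen only through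
    [tangent_map fst] and [tangent_map snd], i.e. through test functions of the
    form [h \o fst] and [h \o snd].  On these a lifted field acts either as the
    original field or as zero, so the projections of a bracket of lifts are
    computed without knowing that a lift maps every smooth function on the
    product to a smooth function, which would require coordinates. *)

Require Import Defs.
From mathcomp Require Import all_boot all_order all_algebra.
From mathcomp Require Import all_classical all_reals all_analysis.
From mathcomp Require Import ring.

Set Implicit Arguments.
Unset Strict Implicit.
Unset Printing Implicit Defensive.

Import GRing.Theory.
Import numFieldNormedType.Exports.

Local Open Scope classical_set_scope.
Local Open Scope ring_scope.

(** * Products of real functions of class $C^k$ *)

Lemma Ck_on_pred (R : realType) (V W : normedModType R) k (A : set V)
    (f : V -> W) : Ck_on k.+1 A f -> Ck_on k A f.
Proof.
elim: k f => [|k IH] f [cf Df]; split=> // v.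
by have [df Dvf] := Df v; split=> //; exact: IH.
Qed.

(** Induction on [k] by the product rule: each summand of the derivative multiplies one factor by a
    derivative of the other, and [Ck_on_pred] lowers the class of the undifferentiated factor to
    match. *)
Lemma Ck_on_mul (R : realType) (V : normedModType R) k (A : set V)
    (f g : V -> R) : open A ->
  Ck_on k A f -> Ck_on k A g -> Ck_on k A (fun x => f x * g x).
Proof.
move=> Ao; elim: k f g => [|k IH] f g Cf Cg.
  by split=> // x Ax; apply: cvgM; [exact: Cf.1 | exact: Cg.1].
have [[cf Df] [cg Dg]] := (Cf, Cg).
split=> [x Ax|v]; first by apply: cvgM; [exact: cf | exact: cg].
have [df Dvf] := Df v; have [dg Dvg] := Dg v; split=> [x Ax|].
  by apply: derivableM; [exact: df | exact: dg].
apply: (@eq_Ck_on _ _ _ _ _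
  ((fun x => f x * 'D_v g x) + (fun x => g x * 'D_v f x))) => //.
  by move=> x Ax; rewrite (deriveM (df x Ax) (dg x Ax)).
by apply: Ck_on_add => //; apply: IH => //; exact: Ck_on_pred.
Qed.

(** * Smooth functions on a manifold and their pullbacks along the projections *)

Section SmoothFunctions.
Context {R : realType}.
Implicit Types M B F : manifold R.

Lemma smooth_fun_cst M (a : R) : smooth_fun (fun _ : M => a).
Proof. by move=> c _ k; exact: Ck_on_cst. Qed.

Lemma smooth_funD M (h k : M -> R) : smooth_fun h -> smooth_fun k ->
  smooth_fun (fun q => h q + k q).
Proof.
move=> sh sk c Mc n; apply: Ck_on_add; first exact: chart_image_open.
- exact: sh.
- exact: sk.
Qed.

Lemma smooth_funM M (h k : M -> R) : smooth_fun h -> smooth_fun k ->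
  smooth_fun (fun q => h q * k q).
Proof.
move=> sh sk c Mc n; apply: Ck_on_mul; first exact: chart_image_open.
- exact: sh.
- exact: sk.
Qed.

(** In a product chart the pullback is the local expression of [h] precomposed with the linear map
    [lsubmx], so stability under affine substitutions is enough. *)
Lemma smooth_fun_fst B F (h : B -> R) : smooth_fun h ->
  smooth_fun (fun z : prod_manifold B F => h z.1).
Proof.
move=> sh _ [[c d] [/= Bc Fd] <-] k.
apply: (@sub_Ck_on _ _ _ _ _ (lsubmx @^-1` (chart_coord c @` chart_dom c))).
  by move=> _ [[p q] [/= cp dq] <-]; rewrite /= row_mxKl; exists p.
apply: (Ck_on_comp_affine (f := h \o chart_param c) (L := lsubmx)).
- exact: continuous_lsubmx.
- by move=> a x v; rewrite linearP.
- exact: sh.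
Qed.

Lemma smooth_fun_snd B F (h : F -> R) : smooth_fun h ->
  smooth_fun (fun z : prod_manifold B F => h z.2).
Proof.
move=> sh _ [[c d] [/= Bc Fd] <-] k.
apply: (@sub_Ck_on _ _ _ _ _ (rsubmx @^-1` (chart_coord d @` chart_dom d))).
  by move=> _ [[p q] [/= cp dq] <-]; rewrite /= row_mxKr; exists q.
apply: (Ck_on_comp_affine (f := h \o chart_param d) (L := rsubmx)).
- exact: continuous_rsubmx.
- by move=> a x v; rewrite linearP.
- exact: sh.
Qed.

End SmoothFunctions.

(** * Derivations at a point, brackets, and degenerate metrics *)

Section TangentVectors.
Context {R : realType}.
Implicit Types M N : manifold R.

Lemma on_smoothE M (v : functional M) h : smooth_fun h -> on_smooth v h = v h.
Proof. by rewrite /on_smooth => sh; case: asboolP. Qed.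

Lemma on_smooth_out M (v : functional M) h :
  ~ smooth_fun h -> on_smooth v h = 0.
Proof. by rewrite /on_smooth => sh; case: asboolP. Qed.

(** [tangent_map], [bracket] and the lifts are all values of [on_smooth], so equalities between them
    need only be checked on smooth test functions. *)
Lemma eq_on_smooth M (v w : functional M) :
  (forall h, smooth_fun h -> v h = w h) -> on_smooth v = on_smooth w.
Proof.
by move=> vw; apply/funext => h; rewrite /on_smooth; case: asboolP => // /vw.
Qed.

Lemma on_smooth_cst0 M : on_smooth (fun _ : M -> R => 0) = fun _ => 0.
Proof. by apply/funext => h; rewrite /on_smooth; case: asboolP. Qed.

Lemma is_tangent0 M (p : M) : is_tangent p (fun _ => 0).
Proof. by split=> *; ring. Qed.

Section Derivation.
Context {M : manifold R} {p : M} {v : functional M} (vp : is_tangent p v).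

Lemma on_smooth_tangent : on_smooth v = v.
Proof.
apply/funext => h; rewrite /on_smooth; case: asboolP => // nh.
by rewrite (tangent_on_smooth vp nh).
Qed.

Lemma tangent_cst (a : R) : v (fun _ => a) = 0.
Proof.
have s1 := @smooth_fun_cst R M 1; have s0 := @smooth_fun_cst R M 0.
(* The Leibniz rule for $1\cdot 1=1$ reads $v(1)=v(1)+v(1)$. *)
have v1 : v (fun _ => 1) = 0.
  have := tangent_leibniz vp s1 s1.
  under eq_fun do rewrite mulr1.
  by rewrite mulr1 mul1r => /esym/eqP; rewrite addrC -subr_eq0 addrK => /eqP.
have v0 : v (fun _ => 0) = 0.
  have := tangent_linear vp 1 s0 s0.
  under eq_fun do rewrite mulr0 addr0.
  by rewrite mul1r => /esym/eqP; rewrite addrC -subr_eq0 addrK => /eqP.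
have := tangent_linear vp a s1 s0.
under eq_fun do rewrite mulr1 addr0.
by rewrite v1 v0 mulr0 addr0.
Qed.

Lemma tangentZ (a : R) h : smooth_fun h -> v (fun q => a * h q) = a * v h.
Proof.
move=> sh; have := tangent_linear vp a sh (@smooth_fun_cst R M 0).
by under eq_fun do rewrite addr0; rewrite tangent_cst addr0.
Qed.

Lemma tangentD h k : smooth_fun h -> smooth_fun k ->
  v (fun q => h q + k q) = v h + v k.
Proof.
move=> sh sk; have := tangent_linear vp 1 sh sk.
by under eq_fun do rewrite mul1r; rewrite mul1r.
Qed.

End Derivation.

(** Two truncations are present: [tangent_map] tests the smoothness of [h], [bracket] that of
    [h \o phi]. Both sides undergo the same tests, and where one fails the claim reads $0=-0$. *)
Lemma tangent_map_bracketC M N (phi : M -> N) (X Y : field M) p :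
  tangent_map phi (bracket X Y p) =
  fun h => - tangent_map phi (bracket Y X p) h.
Proof.
apply/funext => h; rewrite /tangent_map /bracket /on_smooth.
by case: asboolP => _; [case: asboolP => _; [rewrite opprB|rewrite oppr0] |
  rewrite oppr0].
Qed.

(** In the Leibniz rule for $XY-YX$ the cross terms $X(h)Y(k)+Y(h)X(k)$ are symmetric in $X$ and $Y$
    and cancel. Below it is applied on [B] and [F] only, to the projections of brackets of lifts. *)
Lemma is_tangent_bracket M (X Y : field M) p :
  is_vector_field X -> is_vector_field Y -> is_tangent p (bracket X Y p).
Proof.
move=> hX hY.
have tX r := vector_field_tangent hX r.
have tY r := vector_field_tangent hY r.
have sX h (sh : smooth_fun h) := vector_field_smooth hX sh.
have sY h (sh : smooth_fun h) := vector_field_smooth hY sh.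
split=> [a h k sh sk|h k sh sk|h nh]; last by rewrite /bracket on_smooth_out.
- have sah : smooth_fun (fun q => a * h q + k q).
    apply: smooth_funD => //; apply: smooth_funM => //.
    exact: smooth_fun_cst.
  rewrite /bracket !on_smoothE //.
  under [Y^~ _]eq_fun do rewrite (tangent_linear (tY _)) //.
  under [X^~ _]eq_fun do rewrite (tangent_linear (tX _)) //.
  rewrite (tangent_linear (tX _)) ?(tangent_linear (tY _)) //;
    try by [exact: sX | exact: sY].
  ring.
- have shk : smooth_fun (fun q => h q * k q) by exact: smooth_funM.
  rewrite /bracket !on_smoothE //.
  under [Y^~ _]eq_fun do rewrite (tangent_leibniz (tY _)) //.
  under [X^~ _]eq_fun do rewrite (tangent_leibniz (tX _)) //.
  rewrite (tangentD (tX _)) ?(tangentD (tY _));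
    try by apply: smooth_funM => //; (exact: sX || exact: sY).
  rewrite !(tangent_leibniz (tX _)) ?(tangent_leibniz (tY _)) //;
    try by (exact: sX || exact: sY).
  ring.
Qed.

Section Metric.
Context {M : manifold R} {g : tensor2 M} (hg : is_singular_metric g).
Context {p : M} {w : functional M} (wp : is_tangent p w).

(** Linearity applied to $1\cdot 0+0=0$ gives $g(0,w)=g(0,w)+g(0,w)$. *)
Lemma singular_metric0l : g p (fun _ => 0) w = 0.
Proof.
have t0 := is_tangent0 p.
have := singular_metric_linear hg 1 t0 t0 wp.
under eq_fun do rewrite mulr0 addr0.
by rewrite mul1r => /esym/eqP; rewrite addrC -subr_eq0 addrK => /eqP.
Qed.

Lemma singular_metric0r : g p w (fun _ => 0) = 0.
Proof.
by rewrite (singular_metric_sym hg wp (is_tangent0 p)) singular_metric0l.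
Qed.

End Metric.
End TangentVectors.

(** * Lifted fields and their images under the two projections *)

Section Lifts.
Context {R : realType} {B F : manifold R}.
Local Notation fstM := (fst : prod_manifold B F -> B).
Local Notation sndM := (snd : prod_manifold B F -> F).

Lemma lift_baseE (X : field B) (z : prod_manifold B F) h : smooth_fun h ->
  lift_base F X z h = X z.1 (fun p => h (p, z.2)).
Proof. exact: on_smoothE. Qed.

Lemma lift_fiberE (V : field F) (z : prod_manifold B F) h : smooth_fun h ->
  lift_fiber B V z h = V z.2 (fun q => h (z.1, q)).
Proof. exact: on_smoothE. Qed.

Section Base.
Context {X : field B} (hX : is_vector_field X).
Let tX p := vector_field_tangent hX p.

Lemma lift_base_fst z h : smooth_fun h ->
  lift_base F X z (h \o fstM) = X z.1 h.
Proof. by move=> sh; rewrite lift_baseE //; exact: smooth_fun_fst. Qed.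

(** The test function is constant along each slice $B\times\{q\}$, and a derivation kills
    constants. *)
Lemma lift_base_snd z (h : F -> R) : smooth_fun h ->
  lift_base F X z (h \o sndM) = 0.
Proof.
move=> sh; rewrite lift_baseE; first exact: (tangent_cst (tX _) (h z.2)).
exact: smooth_fun_snd.
Qed.

Lemma tangent_map_fst_base z : tangent_map fstM (lift_base F X z) = X z.1.
Proof.
(* The right side is truncated as well, which brings both sides into the form required by
   [eq_on_smooth]. *)
rewrite -[RHS](on_smooth_tangent (tX _)).
by apply: eq_on_smooth => h; exact: lift_base_fst.
Qed.

Lemma tangent_map_snd_base z :
  tangent_map sndM (lift_base F X z) = fun _ => 0.
Proof.
by rewrite -on_smooth_cst0; apply: eq_on_smooth => h; exact: lift_base_snd.
Qed.

End Base.

Section Fiber.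
Context {V : field F} (hV : is_vector_field V).
Let tV q := vector_field_tangent hV q.

Lemma lift_fiber_snd z h : smooth_fun h ->
  lift_fiber B V z (h \o sndM) = V z.2 h.
Proof. by move=> sh; rewrite lift_fiberE //; exact: smooth_fun_snd. Qed.

Lemma lift_fiber_fst z (h : B -> R) : smooth_fun h ->
  lift_fiber B V z (h \o fstM) = 0.
Proof.
move=> sh; rewrite lift_fiberE; first exact: (tangent_cst (tV _) (h z.1)).
exact: smooth_fun_fst.
Qed.

Lemma tangent_map_snd_fiber z : tangent_map sndM (lift_fiber B V z) = V z.2.
Proof.
rewrite -[RHS](on_smooth_tangent (tV _)).
by apply: eq_on_smooth => h; exact: lift_fiber_snd.
Qed.

Lemma tangent_map_fst_fiber z :
  tangent_map fstM (lift_fiber B V z) = fun _ => 0.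
Proof.
by rewrite -on_smooth_cst0; apply: eq_on_smooth => h; exact: lift_fiber_fst.
Qed.

End Fiber.

(** * Projections of brackets of lifted fields *)

Section Bracket.
Context {X Y : field B} {V W : field F}.
Context (hX : is_vector_field X) (hY : is_vector_field Y).
Context (hV : is_vector_field V) (hW : is_vector_field W).
Implicit Type z : prod_manifold B F.

Lemma lift_base_cst (a : R) z : lift_base F X z (fun _ => a) = 0.
Proof.
rewrite lift_baseE; last exact: smooth_fun_cst.
exact: (tangent_cst (vector_field_tangent hX _) a).
Qed.

Lemma lift_fiber_cst (a : R) z : lift_fiber B V z (fun _ => a) = 0.
Proof.
rewrite lift_fiberE; last exact: smooth_fun_cst.
exact: (tangent_cst (vector_field_tangent hV _) a).
Qed.

(** Brackets of $\pi_B$-related fields are $\pi_B$-related: a lift sends $h\circ\pi_B$ to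
    $X(h)\circ\pi_B$, again the pullback of a smooth function, so the second field can be applied in
    the same way. *)
Lemma tangent_map_fst_bracket_base z :
  tangent_map fstM (bracket (lift_base F X) (lift_base F Y) z) =
  bracket X Y z.1.
Proof.
apply: eq_on_smooth => h sh.
rewrite /bracket on_smoothE; last exact: smooth_fun_fst.
have -> : (lift_base F Y)^~ (h \o fstM) = (Y^~ h) \o fstM.
  by apply/funext => z'; exact: lift_base_fst.
have -> : (lift_base F X)^~ (h \o fstM) = (X^~ h) \o fstM.
  by apply/funext => z'; exact: lift_base_fst.
by rewrite !lift_base_fst //; exact: vector_field_smooth.
Qed.

Lemma tangent_map_snd_bracket_base z :
  tangent_map sndM (bracket (lift_base F X) (lift_base F Y) z) = fun _ => 0.
Proof.
rewrite -on_smooth_cst0; apply: eq_on_smooth => h sh.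
rewrite /bracket on_smoothE; last exact: smooth_fun_snd.
have -> : (lift_base F Y)^~ (h \o sndM) = fun _ => 0.
  by apply/funext => z'; exact: lift_base_snd.
have -> : (lift_base F X)^~ (h \o sndM) = fun _ => 0.
  by apply/funext => z'; exact: lift_base_snd.
(* Inside this section [lift_base_cst] speaks of [X] only; the term in [Y] is evaluated from the
   definition of the lift. *)
rewrite lift_base_cst lift_baseE; last exact: smooth_fun_cst.
by rewrite (tangent_cst (vector_field_tangent hY _) 0) subr0.
Qed.

Lemma tangent_map_snd_bracket_fiber z :
  tangent_map sndM (bracket (lift_fiber B V) (lift_fiber B W) z) =
  bracket V W z.2.
Proof.
apply: eq_on_smooth => h sh.
rewrite /bracket on_smoothE; last exact: smooth_fun_snd.
have -> : (lift_fiber B W)^~ (h \o sndM) = (W^~ h) \o sndM.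
  by apply/funext => z'; exact: lift_fiber_snd.
have -> : (lift_fiber B V)^~ (h \o sndM) = (V^~ h) \o sndM.
  by apply/funext => z'; exact: lift_fiber_snd.
by rewrite !lift_fiber_snd //; exact: vector_field_smooth.
Qed.

Lemma tangent_map_fst_bracket_fiber z :
  tangent_map fstM (bracket (lift_fiber B V) (lift_fiber B W) z) = fun _ => 0.
Proof.
rewrite -on_smooth_cst0; apply: eq_on_smooth => h sh.
rewrite /bracket on_smoothE; last exact: smooth_fun_fst.
have -> : (lift_fiber B W)^~ (h \o fstM) = fun _ => 0.
  by apply/funext => z'; exact: lift_fiber_fst.
have -> : (lift_fiber B V)^~ (h \o fstM) = fun _ => 0.
  by apply/funext => z'; exact: lift_fiber_fst.
rewrite lift_fiber_cst lift_fiberE; last exact: smooth_fun_cst.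
by rewrite (tangent_cst (vector_field_tangent hW _) 0) subr0.
Qed.

(** One term differentiates the zero function along [X]; the other differentiates $X(h)\circ\pi_B$,
    which is constant along the fibres, in the direction of [V]. *)
Lemma tangent_map_fst_bracket_mixed z :
  tangent_map fstM (bracket (lift_base F X) (lift_fiber B V) z) = fun _ => 0.
Proof.
rewrite -on_smooth_cst0; apply: eq_on_smooth => h sh.
rewrite /bracket on_smoothE; last exact: smooth_fun_fst.
have -> : (lift_fiber B V)^~ (h \o fstM) = fun _ => 0.
  by apply/funext => z'; exact: lift_fiber_fst.
have -> : (lift_base F X)^~ (h \o fstM) = (X^~ h) \o fstM.
  by apply/funext => z'; exact: lift_base_fst.
rewrite lift_base_cst lift_fiber_fst ?subr0 //.
exact: vector_field_smooth.
Qed.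

Lemma tangent_map_snd_bracket_mixed z :
  tangent_map sndM (bracket (lift_base F X) (lift_fiber B V) z) = fun _ => 0.
Proof.
rewrite -on_smooth_cst0; apply: eq_on_smooth => h sh.
rewrite /bracket on_smoothE; last exact: smooth_fun_snd.
have -> : (lift_fiber B V)^~ (h \o sndM) = (V^~ h) \o sndM.
  by apply/funext => z'; exact: lift_fiber_snd.
have -> : (lift_base F X)^~ (h \o sndM) = fun _ => 0.
  by apply/funext => z'; exact: lift_base_snd.
rewrite lift_fiber_cst lift_base_snd ?subr0 //.
exact: vector_field_smooth.
Qed.

(** The Koszul form contains mixed brackets in both orders; this order follows by antisymmetry. *)
Lemma tangent_map_fst_bracket_mixedC z :
  tangent_map fstM (bracket (lift_fiber B V) (lift_base F X) z) = fun _ => 0.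
Proof.
rewrite tangent_map_bracketC tangent_map_fst_bracket_mixed.
by apply/funext => h; rewrite oppr0.
Qed.

Lemma tangent_map_snd_bracket_mixedC z :
  tangent_map sndM (bracket (lift_fiber B V) (lift_base F X) z) = fun _ => 0.
Proof.
rewrite tangent_map_bracketC tangent_map_snd_bracket_mixed.
by apply/funext => h; rewrite oppr0.
Qed.

End Bracket.
End Lifts.

(** * Values of the warped metric on lifts and on their brackets *)

Section WarpedMetric.
Context {R : realType} {B F : manifold R} {gB : tensor2 B} {gF : tensor2 F}.
Context {f : B -> R} (hgB : is_singular_metric gB).
Context (hgF : is_singular_metric gF) (hf : smooth_fun f).
Local Notation fstM := (fst : prod_manifold B F -> B).
Local Notation sndM := (snd : prod_manifold B F -> F).
Local Notation g := (warped_metric f gB gF).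
Local Notation LB := (lift_base F).
Local Notation LF := (lift_fiber B).
Implicit Type z : prod_manifold B F.

(** The fibre part of a base lift is zero, which kills the $g_F$ term. Tangency is asked only of the
    projection of [v], so that [v] may be a bracket of lifts, not known to be tangent to the
    product. *)
Lemma warped_metric_base X z v : is_vector_field X ->
  is_tangent z.2 (tangent_map sndM v) ->
  g z (LB X z) v = gB z.1 (X z.1) (tangent_map fstM v).
Proof.
move=> hX tv; rewrite /warped_metric /pullback_tensor.
rewrite tangent_map_fst_base // tangent_map_snd_base //.
by rewrite (singular_metric0l hgF tv) mulr0 addr0.
Qed.

Lemma warped_metric_fiber V z v : is_vector_field V ->
  is_tangent z.1 (tangent_map fstM v) ->
  g z (LF V z) v = f z.1 ^+ 2 * gF z.2 (V z.2) (tangent_map sndM v).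
Proof.
move=> hV tv; rewrite /warped_metric /pullback_tensor.
rewrite tangent_map_fst_fiber // tangent_map_snd_fiber //.
by rewrite (singular_metric0l hgB tv) add0r.
Qed.

Section Fields.
Context {X Y Z : field B} {U V W : field F}.
Context (hX : is_vector_field X) (hY : is_vector_field Y).
Context (hZ : is_vector_field Z) (hU : is_vector_field U).
Context (hV : is_vector_field V) (hW : is_vector_field W).
Let tX p := vector_field_tangent hX p.
Let tU p := vector_field_tangent hU p.
Let tV p := vector_field_tangent hV p.

Lemma warped_metric_base_base z :
  g z (LB X z) (LB Y z) = gB z.1 (X z.1) (Y z.1).
Proof.
by rewrite warped_metric_base ?tangent_map_fst_base //
  tangent_map_snd_base //; exact: is_tangent0.
Qed.

Lemma warped_metric_base_fiber z : g z (LB X z) (LF V z) = 0.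
Proof.
by rewrite warped_metric_base ?tangent_map_fst_fiber ?tangent_map_snd_fiber
  ?(singular_metric0r hgB).
Qed.

Lemma warped_metric_fiber_base z : g z (LF V z) (LB X z) = 0.
Proof.
by rewrite warped_metric_fiber ?tangent_map_fst_base ?tangent_map_snd_base
  ?(singular_metric0r hgF) ?mulr0.
Qed.

Lemma warped_metric_fiber_fiber z :
  g z (LF V z) (LF W z) = f z.1 ^+ 2 * gF z.2 (V z.2) (W z.2).
Proof.
by rewrite warped_metric_fiber ?tangent_map_snd_fiber //
  tangent_map_fst_fiber //; exact: is_tangent0.
Qed.

Lemma warped_metric_base_bracket_base z :
  g z (LB X z) (bracket (LB Y) (LB Z) z) =
  gB z.1 (X z.1) (bracket Y Z z.1).
Proof.
by rewrite warped_metric_base ?tangent_map_fst_bracket_base //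
  tangent_map_snd_bracket_base //; exact: is_tangent0.
Qed.

Lemma warped_metric_base_bracket_fiber z :
  g z (LB X z) (bracket (LF V) (LF W) z) = 0.
Proof.
rewrite warped_metric_base ?tangent_map_fst_bracket_fiber
  ?tangent_map_snd_bracket_fiber ?(singular_metric0r hgB) //.
(* The bracket projects to [bracket V W] on [F]; its tangency is what makes $g_F(0,[V,W])$
   vanish. *)
exact: is_tangent_bracket.
Qed.

Lemma warped_metric_base_bracket_mixed z :
  g z (LB X z) (bracket (LB Y) (LF V) z) = 0.
Proof.
by rewrite warped_metric_base ?tangent_map_fst_bracket_mixed
  ?tangent_map_snd_bracket_mixed ?(singular_metric0r hgB) //;
  exact: is_tangent0.
Qed.

Lemma warped_metric_fiber_bracket_base z :
  g z (LF V z) (bracket (LB X) (LB Y) z) = 0.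
Proof.
rewrite warped_metric_fiber ?tangent_map_fst_bracket_base
  ?tangent_map_snd_bracket_base ?(singular_metric0r hgF) ?mulr0 //.
exact: is_tangent_bracket.
Qed.

Lemma warped_metric_fiber_bracket_fiber z :
  g z (LF U z) (bracket (LF V) (LF W) z) =
  f z.1 ^+ 2 * gF z.2 (U z.2) (bracket V W z.2).
Proof.
by rewrite warped_metric_fiber ?tangent_map_snd_bracket_fiber //
  tangent_map_fst_bracket_fiber //; exact: is_tangent0.
Qed.

Lemma warped_metric_fiber_bracket_mixed z :
  g z (LF U z) (bracket (LB X) (LF V) z) = 0.
Proof.
by rewrite warped_metric_fiber ?tangent_map_fst_bracket_mixed
  ?tangent_map_snd_bracket_mixed ?(singular_metric0r hgF) ?mulr0 //;
  exact: is_tangent0.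
Qed.

Lemma warped_metric_base_bracket_mixedC z :
  g z (LB X z) (bracket (LF V) (LB Y) z) = 0.
Proof.
by rewrite warped_metric_base ?tangent_map_fst_bracket_mixedC
  ?tangent_map_snd_bracket_mixedC ?(singular_metric0r hgB) //;
  exact: is_tangent0.
Qed.

Lemma warped_metric_fiber_bracket_mixedC z :
  g z (LF U z) (bracket (LF V) (LB X) z) = 0.
Proof.
by rewrite warped_metric_fiber ?tangent_map_fst_bracket_mixedC
  ?tangent_map_snd_bracket_mixedC ?(singular_metric0r hgF) ?mulr0 //;
  exact: is_tangent0.
Qed.

End Fields.

(** * Derivatives of metric components along lifted fields *)

Section Derivatives.
Context {X Y Z : field B} {U V W : field F}.
Context (hX : is_vector_field X) (hY : is_vector_field Y).
Context (hZ : is_vector_field Z) (hU : is_vector_field U).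
Context (hV : is_vector_field V) (hW : is_vector_field W).
Let gBs : smooth_fun (fun p => gB p (Y p) (Z p)) :=
  singular_metric_smooth hgB hY hZ.
Let gFs : smooth_fun (fun q => gF q (V q) (W q)) :=
  singular_metric_smooth hgF hV hW.
(** The square is convertible to the product [f p * f p]. *)
Let f2s : smooth_fun (fun p => f p ^+ 2) := smooth_funM hf hf.

Lemma base_warped_metric_base z :
  LB X z (fun y => g y (LB Y y) (LB Z y)) =
  X z.1 (fun p => gB p (Y p) (Z p)).
Proof.
under eq_fun do rewrite warped_metric_base_base //.
exact: lift_base_fst.
Qed.

Lemma fiber_warped_metric_base z :
  LF U z (fun y => g y (LB Y y) (LB Z y)) = 0.
Proof.
under eq_fun do rewrite warped_metric_base_base //.
exact: (lift_fiber_fst hU z gBs).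
Qed.

(** The source of $X(f)$ in the theorem: along the base $g_F(V,W)$ is constant and $X(f^2)=2fX(f)$.
    The factor 2 will cancel the one half of the Koszul form. *)
Lemma base_warped_metric_fiber z :
  LB X z (fun y => g y (LF V y) (LF W y)) =
  (f z.1 * gF z.2 (V z.2) (W z.2) * X z.1 f) *+ 2.
Proof.
under eq_fun do rewrite warped_metric_fiber_fiber //.
rewrite lift_baseE /=; last first.
  exact: smooth_funM (smooth_fun_fst f2s) (smooth_fun_snd gFs).
(* The constant $g_F(V,W)$ moves to the left, where [tangentZ] extracts it. *)
under eq_fun do rewrite mulrC.
have tX := vector_field_tangent hX z.1.
by rewrite (tangentZ tX) // (tangent_leibniz tX) //; ring.
Qed.

(** Along a fibre $f^2$ is a constant and leaves the derivation as a scalar; no division by $f$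
    occurs, so its zeros are harmless. *)
Lemma fiber_warped_metric_fiber z :
  LF U z (fun y => g y (LF V y) (LF W y)) =
  f z.1 ^+ 2 * U z.2 (fun q => gF q (V q) (W q)).
Proof.
under eq_fun do rewrite warped_metric_fiber_fiber //.
rewrite lift_fiberE /=; last first.
  exact: smooth_funM (smooth_fun_fst f2s) (smooth_fun_snd gFs).
by rewrite (tangentZ (vector_field_tangent hU z.2)).
Qed.

Lemma base_warped_metric_mixed z :
  LB X z (fun y => g y (LB Y y) (LF V y)) = 0.
Proof.
under eq_fun do rewrite warped_metric_base_fiber //.
exact: lift_base_cst.
Qed.

Lemma base_warped_metric_mixedC z :
  LB X z (fun y => g y (LF V y) (LB Y y)) = 0.
Proof.
under eq_fun do rewrite warped_metric_fiber_base //.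
exact: lift_base_cst.
Qed.

Lemma fiber_warped_metric_mixed z :
  LF U z (fun y => g y (LB Y y) (LF V y)) = 0.
Proof.
under eq_fun do rewrite warped_metric_base_fiber //.
exact: lift_fiber_cst.
Qed.

Lemma fiber_warped_metric_mixedC z :
  LF U z (fun y => g y (LF V y) (LB Y y)) = 0.
Proof.
under eq_fun do rewrite warped_metric_fiber_base //.
exact: lift_fiber_cst.
Qed.

End Derivatives.

End WarpedMetric.

(** * Assembly of the five formulas *)

Theorem proposition2p15 (R : realType) (B F : manifold R)
    (gB : tensor2 B) (gF : tensor2 F) (f : B -> R)
    (hgB : is_singular_metric gB) (hgF : is_singular_metric gF)
    (hf : smooth_fun f)
    (X Y Z P : field B) (U V W : field F)
    (hX : is_vector_field X) (hY : is_vector_field Y)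
    (hZ : is_vector_field Z) (hP : is_vector_field P)
    (hU : is_vector_field U) (hV : is_vector_field V)
    (hW : is_vector_field W) :
  let g := warped_metric f gB gF in
  let K := ss_koszul g (lift_base F P) in
  let X' := lift_base F X in
  let Y' := lift_base F Y in
  let Z' := lift_base F Z in
  let U' := lift_fiber B U in
  let V' := lift_fiber B V in
  let W' := lift_fiber B W in
  forall (p : B) (q : F),
  [/\ K X' Y' Z' (p, q) = ss_koszul gB P X Y Z p,
      [/\ K X' Y' W' (p, q) = 0, K X' W' Y' (p, q) = 0
        & K W' X' Y' (p, q) = 0],
      K X' V' W' (p, q) = f p * gF q (V q) (W q) * X p f,
      K V' X' W' (p, q) = - K V' W' X' (p, q) /\
      K V' X' W' (p, q) = f p * gF q (V q) (W q) * X p f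
                          + f p ^+ 2 * gB p (X p) (P p) * gF q (V q) (W q)
    & K U' V' W' (p, q) = f p ^+ 2 * koszul gF U V W q].
Proof.
move=> g K X' Y' Z' U' V' W' p q.
(* The permuted arguments in (4) produce $g_F(W,V)$ and $g_B(P,X)$; symmetry brings them to the
   order of the statement. *)
have gWV : gF q (W q) (V q) = gF q (V q) (W q).
  by apply: (singular_metric_sym hgF); exact: vector_field_tangent.
have gPX : gB p (P p) (X p) = gB p (X p) (P p).
  by apply: (singular_metric_sym hgB); exact: vector_field_tangent.
rewrite /K /ss_koszul /koszul /g /X' /Y' /Z' /U' /V' /W'.
(* The terms are evaluated by kind: derivatives of inner products, then inner products with
   brackets, and last the inner products of the correction terms in [P]. *)
rewrite !(base_warped_metric_base, fiber_warped_metric_base,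
  base_warped_metric_fiber, fiber_warped_metric_fiber,
  base_warped_metric_mixed, base_warped_metric_mixedC,
  fiber_warped_metric_mixed, fiber_warped_metric_mixedC) //.
rewrite !(warped_metric_base_bracket_base, warped_metric_base_bracket_fiber,
  warped_metric_base_bracket_mixed, warped_metric_base_bracket_mixedC,
  warped_metric_fiber_bracket_base, warped_metric_fiber_bracket_fiber,
  warped_metric_fiber_bracket_mixed, warped_metric_fiber_bracket_mixedC) //.
rewrite !(warped_metric_base_base, warped_metric_base_fiber,
  warped_metric_fiber_base, warped_metric_fiber_fiber) //=.
(* Both sides of (1) now coincide syntactically; in (5) the factor $f^2$ is collected. *)
rewrite gWV gPX; split=> //; last by ring.
- by split; ring.
(* In (3) and (4) the factor [2^-1] must cancel the 2 from $X(f^2)$, hence [field] instead of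
   [ring]. *)
- by field.
- by split; field.
Qed.
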